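(* Let $G$ be a connected weighted graph on $N$ nodes that is symmetric (its adjacency matrix satisfies $A=A^*$), with Laplacian matrix $L$, and let $\Delta>0$. Let $x:[0,+\infty)\to\mathbb{R}^N$ be any Krasowskii solution to $\dot x=-L\,\mathtt q(x)$, where $\mathtt q$ is the uniform quantizer of step $\Delta$. Let $$\mathcal D=\{x\in\mathbb{R}^N:\ \exists k\in\mathbb{Z}\text{ such that }\mathtt q(x_i)=\Delta k\ \text{ for all } i\in\{1,\dots,N\}\}.$$ Then $\mathrm{dist}(x(t),\mathcal D)\to0$ as $t\to+\infty$.
   Context: A weighted graph $G=(V,E,A)$ has node set $V=\{1,\dots,N\}$, edge set $E\subset V\times V$ without self-loops, and adjacency matrix $A\in\mathbb{R}_{\ge0}^{N\times N}$ with $A_{ij}>0$ if $(j,i)\in E$ and $A_{ij}=0$ otherwise. Connected means that any two nodes are joined by a path of edges. $L=\mathrm{diag}(A\mathbf 1)-A$ is the Laplacian, where $\mathbf 1$ is the all-ones vector. $\mathrm{dist}$ is Euclidean distance to a set. Uniform quantizer: $\mathtt q(r)=\lfloor \frac{r}{\Delta}+\frac12\rfloor\Delta$ for $r\in\mathbb{R}$, applied componentwise to vectors. A Krasowskii solution to $\dot x=-L\mathtt q(x)$ on an interval $I$ is an absolutely continuous function (locally absolutely continuous if $I$ is unbounded) $x:I\to\mathbb{R}^N$ such that $\dot x(t)\in\mathcal K(-L\mathtt q(x(t)))$ for almost every $t\in I$, where $\mathcal K(-L\mathtt q(x))=\bigcap_{\delta>0}\overline{\mathrm{co}}\,\{-L\mathtt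 q(y): y\in B(x,\delta)\}$, with $B(x,\delta)$ the Euclidean ball of radius $\delta$ centered at $x$ and $\overline{\mathrm{co}}$ the closed convex hull. *)

(* Defs.v *)
From HB Require Import structures.
From mathcomp Require Import all_boot all_order all_algebra.
From mathcomp Require Import all_classical all_reals all_analysis.

Set Implicit Arguments.
Unset Strict Implicit.
Unset Printing Implicit Defensive.

Import Order.TTheory GRing.Theory Num.Theory.
Import numFieldNormedType.Exports.

Local Open Scope classical_set_scope.
Local Open Scope ring_scope.

(* [edge G j i] is the edge (j, i), which carries the weight [adj G i j]. *)
Record weighted_graph (R : realType) (N : nat) := WeightedGraph {
  edge : rel 'I_N;
  adj : 'M[R]_N;
  edge_irrefl : irreflexive edge;
  adj_gt0 : forall i j, edge j i -> 0 < adj i j;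
  adj_eq0 : forall i j, ~~ edge j i -> adj i j = 0 }.

Definition connected_graph (R : realType) (N : nat)
    (G : weighted_graph R N) : Prop :=
  forall i j : 'I_N, connect (edge G) i j.

Definition symmetric_graph (R : realType) (N : nat)
    (G : weighted_graph R N) : Prop :=
  adj G = (adj G)^T.

Definition laplacian (R : realType) (N : nat)
    (G : weighted_graph R N) : 'M[R]_N :=
  diag_mx (adj G *m const_mx 1 : 'cV[R]_N)^T - adj G.

(* The library's norm [`|v|] on matrices is the maximum norm, so the
   Euclidean norm is needed separately; both induce the same topology, hence
   the same closures and derivatives. *)
Definition enorm (R : realType) (N : nat) (v : 'cV[R]_N) : R :=
  Num.sqrt (\sum_(i < N) v i 0 ^+ 2).

Definition eball (R : realType) (N : nat) (x : 'cV[R]_N) (d : R) :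
    set 'cV[R]_N :=
  [set y | enorm (y - x) < d].

Definition edistance (R : realType) (N : nat) (x : 'cV[R]_N)
    (S : set 'cV[R]_N) : R :=
  inf [set enorm (x - y) | y in S].

Definition quantizer (R : realType) (Delta : R) (r : R) : R :=
  (Num.floor (r / Delta + 1 / 2))%:~R * Delta.

Definition quantize (R : realType) (N : nat) (Delta : R) (x : 'cV[R]_N) :
    'cV[R]_N :=
  map_mx (quantizer Delta) x.

Definition convex_hull (R : realType) (N : nat) (S : set 'cV[R]_N) :
    set 'cV[R]_N :=
  smallest (@convex_set R 'cV[R]_N) S.

Definition krasowskii (R : realType) (N : nat) (f : 'cV[R]_N -> 'cV[R]_N)
    (x : 'cV[R]_N) : set 'cV[R]_N :=
  \bigcap_(d in [set d : R | 0 < d]) closure (convex_hull (f @` eball x d)).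

Definition abs_continuous (R : realType) (N : nat) (a b : R)
    (x : R -> 'cV[R]_N) : Prop :=
  forall e : R, 0 < e -> exists2 d : R, 0 < d &
    forall (n : nat) (s t : 'I_n -> R),
      (forall i, [/\ a <= s i, s i <= t i & t i <= b]) ->
      trivIset [set: 'I_n] (fun i => `]s i, t i[%classic) ->
      \sum_(i < n) (t i - s i) < d ->
      \sum_(i < n) enorm (x (t i) - x (s i)) < e.

(* A function on [0, +oo[ is represented by a function on R whose values at
   negative times are irrelevant: the time 0, the only one at which the
   two-sided derivative could see them, is Lebesgue-negligible. *)
Definition krasowskii_solution (R : realType) (N : nat)
    (f : 'cV[R]_N -> 'cV[R]_N) (x : R -> 'cV[R]_N) : Prop :=
  (forall a b : R, 0 <= a -> a <= b -> abs_continuous a b x) /\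
  {ae (@lebesgue_measure R), forall t : R, 0 <= t ->
    derivable x t 1 /\ krasowskii f (x t) (derive x t 1)}.

Definition quantized_consensus (R : realType) (N : nat) (Delta : R) :
    set 'cV[R]_N :=
  [set x | exists k : int, forall i : 'I_N,
    quantizer Delta (x i 0) = Delta * k%:~R].

(* Main.v *)
(* The quantizer is a selection of the subdifferential of the convex function
   [potential], so that a Krasowskii velocity at [x] is [- L w] for a
   subgradient [w] of [V x = sum_i potential (x_i)] at [x]. Along a solution
   [V] therefore decreases at rate [w^T L w]. Outside of the closure of the
   consensus set every subgradient [w] has two entries at least [Delta] apart,
   whence by connectedness [w^T L w] is bounded below and dominates [|L w|]: the
   distance travelled there is at most a multiple of the drop of [V]. Once [V]
   is close to its infimum, a solution far from the consensus set could never
   reach it, and [V] would decrease to [-oo]. *)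
Require Import Defs.
From mathcomp Require Import all_boot all_order all_algebra.
From mathcomp Require Import all_classical all_reals all_analysis.
From mathcomp Require Import ring lra.

Import Order.TTheory GRing.Theory Num.Theory.
Import numFieldNormedType.Exports.

Local Open Scope classical_set_scope.
Local Open Scope ring_scope.

(** * Monotonicity of absolutely continuous real functions *)

Definition real_abs_continuous {R : realType} (a b : R) (f : R -> R) : Prop :=
  forall e : R, 0 < e -> exists2 d : R, 0 < d &
    forall (n : nat) (s t : 'I_n -> R),
      (forall i, [/\ a <= s i, s i <= t i & t i <= b]) ->
      trivIset [set: 'I_n] (fun i => `]s i, t i[%classic) ->
      \sum_(i < n) (t i - s i) < d ->
      \sum_(i < n) `|f (t i) - f (s i)| < e.

Lemma real_abs_continuous_unif {R : realType} {a b : R} {f : R -> R} :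
  real_abs_continuous a b f -> forall e : R, 0 < e ->
  exists2 d : R, 0 < d & forall s t, a <= s -> s <= t -> t <= b ->
    t - s < d -> `|f t - f s| < e.
Proof.
move=> acf e e0; have [d d0 H] := acf e e0; exists d => // s t as_ st tb std.
have := H 1%N (fun=> s) (fun=> t); rewrite !big_ord1; apply => //.
by move=> i j _ _ _; rewrite !ord1.
Qed.

(** Turns a small measure of [U] into the small total length that absolute continuity asks for. *)
Lemma sum_length_le {R : realType} (n : nat) (s t : 'I_n -> R) (U : set R) :
  measurable U -> (forall i, s i <= t i) ->
  (forall i, `]s i, t i[%classic `<=` U) ->
  trivIset [set: 'I_n] (fun i => `]s i, t i[%classic) ->
  ((\sum_(i < n) (t i - s i))%:E <= lebesgue_measure U)%E.
Proof.
move=> mU st sU tr.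
have mF i : measurable (`]s i, t i[%classic : set R) by exact: measurable_itv.
have mB : measurable (\big[setU/set0]_(i < n) (`]s i, t i[%classic : set R)).
  exact: bigsetU_measurable.
have -> : (\sum_(i < n) (t i - s i))%:E =
    lebesgue_measure (\big[setU/set0]_(i < n) (`]s i, t i[%classic : set R)).
  rewrite measure_semi_additive_ord // -sumEFin; apply: eq_bigr => i _.
  rewrite [RHS]lebesgue_measure_itv /= lte_fin.
  case: ltP => [//|ts]; congr EFin.
  by apply/eqP; rewrite subr_eq0 eq_le ts st.
apply: le_measure; rewrite ?inE //.
apply: (big_ind (fun V : set R => V `<=` U)) => // A B AU BU.
by rewrite subUset.
Qed.

(* Cover the exceptional null set by an open set [U] of small measure, and push
   a real induction from [b] down to [a]: at a good point [f] grows slowly to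
   the left, at a bad one the increment is charged to an interval inside [U],
   and the total charge is small by absolute continuity. *)
Lemma abs_continuous_nonincreasing {R : realType} (a b : R) (f : R -> R) :
  a <= b -> real_abs_continuous a b f ->
  {ae (@lebesgue_measure R), forall t : R, a <= t <= b ->
    forall e, 0 < e -> exists2 d : R, 0 < d & forall s, a <= s -> s < t ->
      t - d < s -> f t - f s <= e * (t - s)} ->
  f b <= f a.
Proof.
move=> ab acf [A [mA A0 sA]].
suff H e : 0 < e -> f b - f a <= e.
  by rewrite -subr_le0; apply/ler_addgt0Pl => e /H; rewrite addr0.
(* The budget [e] covers slope [e1] over the whole interval, a gap of [e1] and a charge below [e1];
   the last share is slack. *)
move=> e0; pose e1 := e / (b - a + 3).
have ba3 : 0 < b - a + 3 by lra.
have e10 : 0 < e1 by rewrite divr_gt0.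
have [d d0 Hd] := acf _ e10.
have [U [oU AU Ud]] : exists U : set R,
    [/\ open U, A `<=` U & (lebesgue_measure U < d%:E)%E].
  have [|U [oU AU Ud]] := @lebesgue_regularity_outer R A d mA _ d0.
    by rewrite [X in (X < _)%E]A0 ltry.
  exists U; split => //.
  have mU : measurable U by exact: measurable_realfun.open_measurable.
  rewrite -(setDUK AU) (le_lt_trans (measureU2 _ _ _)) //.
    exact: measurableD.
  by rewrite [X in (X + _)%E]A0 add0e.
have mU : measurable U by exact: measurable_realfun.open_measurable.
pose family (s : R) n (u v : 'I_n -> R) :=
  [/\ forall i, [/\ s <= u i, u i <= v i & v i <= b],
      trivIset [set: 'I_n] (fun i => `]u i, v i[%classic) &
      forall i, `]u i, v i[%classic `<=` U].
(* The arbitrary gap [g] makes [P] pass to the infimum [T]: half of it goes to [P] at a nearby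
   point, half to the continuity of [f]. *)
pose P s := forall g, 0 < g -> exists n (u v : 'I_n -> R), family s n u v /\
  f b - f s <= e1 * (b - s) + g + \sum_(i < n) (f (v i) - f (u i)).
suff Pa : P a.
  have [n [u [v [[fam tr uvU] Hf]]]] := Pa _ e10.
  have lt_d : \sum_(i < n) (v i - u i) < d.
    rewrite -lte_fin; apply: le_lt_trans Ud; apply: sum_length_le => //.
    by move=> i; case: (fam i).
  have := Hd n u v fam tr lt_d.
  have : \sum_(i < n) (f (v i) - f (u i)) <= \sum_(i < n) `|f (v i) - f (u i)|.
    by apply: ler_sum => i _; exact: ler_norm.
  have -> : e = e1 * (b - a) + e1 + e1 + e1.
    by rewrite /e1; field; rewrite lt0r_neq0.
  lra.
have Pb : P b.
  move=> g g0; exists 0%N, (fun=> 0), (fun=> 0); split; last first.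
    by rewrite big_ord0; lra.
  by split => [[]//|i|[]//]; case: i.
pose S := [set s | a <= s <= b /\ P s].
have Sb : S b by split => //; rewrite ab lexx.
have lS : lbound S a by move=> s [/andP[]].
have hS : has_inf S by split; [exists b | exists a].
have Tb : inf S <= b by apply: ge_inf => //; exists a.
have aT : a <= inf S by apply: lb_le_inf => //; exists b.
set T := inf S in Tb aT.
have PT : P T.
  move=> g g0; have g20 : 0 < g / 2 by rewrite divr_gt0.
  have [r r0 Hr] := real_abs_continuous_unif acf _ g20.
  have [s [/andP[as_ sb] Ps]] := inf_adherent r0 hS.
  rewrite -/T => sT.
  have Ts : T <= s by apply: ge_inf; [exists a | split => //; apply/andP].
  have [n [u [v [[fam tr uvU] Hf]]]] := Ps _ g20.
  exists n, u, v; split.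
    split => // i; have [H1 H2 H3] := fam i; split => //; exact: le_trans H1.
  have /Hr/(_ Ts sb) : a <= T by [].
  have sTr : s - T < r by lra.
  move=> /(_ sTr); rewrite ltr_norml => /andP[_ HT].
  have : e1 * (b - s) <= e1 * (b - T) by rewrite ler_pM2l //; lra.
  lra.
have [TA|] := eqVneq T a; first by rewrite -TA.
move=> Tna; have aT' : a < T by rewrite lt_neqAle eq_sym Tna.
exfalso.
suff [s [as_ sT Ps]] : exists s, [/\ a <= s, s < T & P s].
  have : T <= s.
    by apply: ge_inf; [exists a | split => //; rewrite as_ (le_trans (ltW sT))].
  by rewrite leNgt sT.
have [AT|nAT] := pselect (A T).
  have /oU := AU _ AT; rewrite /interior => /nbhs_ballP[r /= r0 rU].
  pose s := Num.max a (T - r / 2).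
  have sT : s < T by rewrite /s gt_max aT' /=; lra.
  exists s; split => //; first by rewrite /s le_max lexx.
  move=> g g0; have [n [u [v [[fam tr uvU] Hf]]]] := PT _ g0.
  (* [T] is exceptional, so the interval from [s] to [T] lies in [U] and is prepended to the family
     as index [ord0]. *)
  pose u' (i : 'I_n.+1) := if unlift ord0 i is Some j then u j else s.
  pose v' (i : 'I_n.+1) := if unlift ord0 i is Some j then v j else T.
  have u0 : u' ord0 = s by rewrite /u' unlift_none.
  have v0 : v' ord0 = T by rewrite /v' unlift_none.
  have uS j : u' (lift ord0 j) = u j by rewrite /u' liftK.
  have vS j : v' (lift ord0 j) = v j by rewrite /v' liftK.
  exists n.+1, u', v'; split; last first.
    rewrite big_ord_recl u0 v0; under eq_bigr do rewrite uS vS.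
    have : e1 * (b - T) <= e1 * (b - s) by rewrite ler_pM2l //; lra.
    lra.
  split.
  - move=> i; case: (unliftP ord0 i) => [j ->|->].
      rewrite uS vS; have [H1 H2 H3] := fam j; split => //; lra.
    by rewrite u0 v0; split => //; exact: ltW.
  - move=> i j _ _.
    case: (unliftP ord0 i) => [i' ->|->]; case: (unliftP ord0 j) => [j' ->|->];
      rewrite ?uS ?vS ?u0 ?v0 //.
    + by move=> H; rewrite (tr i' j').
    + move=> [z [/=]]; rewrite !in_itv /=; have [H1 H2 H3] := fam i'.
      by move=> [/andP[? ?] /andP[? ?]]; exfalso; lra.
    + move=> [z [/=]]; rewrite !in_itv /=; have [H1 H2 H3] := fam j'.
      by move=> [/andP[? ?] /andP[? ?]]; exfalso; lra.
  - move=> i; case: (unliftP ord0 i) => [j ->|->]; rewrite ?uS ?vS ?u0 ?v0 //.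
    move=> z /=; rewrite in_itv /= => /andP[sz zT]; apply: rU.
    rewrite /ball /= ger0_norm; last lra.
    have : T - r / 2 <= s by rewrite /s le_max lexx orbT.
    lra.
(* [T] is a good point: slope [e1] pays for the move from [T] to [s], and the family stays the
   same. *)
have [r r0 Hr] : exists2 d : R, 0 < d & forall s, a <= s -> s < T ->
    T - d < s -> f T - f s <= e1 * (T - s).
  have : (~` (~` [set t : R | a <= t <= b ->
    forall e, 0 < e -> exists2 d : R, 0 < d & forall s, a <= s -> s < t ->
      t - d < s -> f t - f s <= e * (t - s)])) T by move=> /sA.
  by rewrite setCK /=; apply => //; rewrite aT Tb.
pose s := Num.max a (T - r / 2).
have as_ : a <= s by rewrite /s le_max lexx.
have sT : s < T by rewrite /s gt_max aT' /=; lra.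
have Trs : T - r < s by rewrite /s lt_max; apply/orP; right; lra.
exists s; split => //.
move=> g g0; have [n [u [v [[fam tr uvU] Hf]]]] := PT _ g0.
exists n, u, v; split.
  split => // i; have [H1 H2 H3] := fam i; split => //; lra.
have := Hr s as_ sT Trs; lra.
Qed.

(** * Dirichlet form and coercivity of the Laplacian *)

Definition dirichlet {R : realType} {N : nat} (A : 'M[R]_N)
    (w : 'cV[R]_N) : R :=
  \sum_i \sum_j A i j * (w i 0 - w j 0) ^+ 2.

Lemma adj_ge0 {R : realType} {N : nat} (G : weighted_graph R N) i j :
  0 <= adj G i j.
Proof.
case: (boolP (edge G j i)) => [/adj_gt0/ltW //|/adj_eq0 ->]; exact: lexx.
Qed.

Lemma dirichlet_term_ge0 {R : realType} {N : nat} (G : weighted_graph R N)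
    (w : 'cV[R]_N) i j : 0 <= adj G i j * (w i 0 - w j 0) ^+ 2.
Proof. by rewrite mulr_ge0 ?adj_ge0 ?sqr_ge0. Qed.

Lemma laplacianE {R : realType} {N : nat} (G : weighted_graph R N)
    (w : 'cV[R]_N) i :
  (laplacian G *m w) i 0 = \sum_j adj G i j * (w i 0 - w j 0).
Proof.
rewrite /laplacian mulmxBl mxE mul_diag_mx !mxE.
rewrite mulr_suml -sumrB; apply: eq_bigr => j _.
by rewrite !mxE mulr1 mulrBr.
Qed.

(** Exchanging the summation indices and using the symmetry of the weights gives a second expression
    of the left-hand side; the two add up to the Dirichlet sum, which counts ordered pairs. *)
Lemma laplacian_quadratic {R : realType} {N : nat} (G : weighted_graph R N)
    (w : 'cV[R]_N) : symmetric_graph G ->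
  \sum_i w i 0 * (laplacian G *m w) i 0 = dirichlet (adj G) w / 2.
Proof.
move=> symG; have symA i j : adj G i j = adj G j i by rewrite {1}symG mxE.
have -> : \sum_i w i 0 * (laplacian G *m w) i 0 =
    \sum_i \sum_j w i 0 * (adj G i j * (w i 0 - w j 0)).
  by apply: eq_bigr => i _; rewrite laplacianE mulr_sumr.
set S := LHS.
have S1 : S = \sum_i \sum_j - (w j 0 * (adj G i j * (w i 0 - w j 0))).
  rewrite /S exchange_big /=; apply: eq_bigr => i _; apply: eq_bigr => j _.
  by rewrite symA; ring.
suff : S + S = dirichlet (adj G) w by move=> <-; field.
rewrite {2}S1 /S -big_split; apply: eq_bigr => i _ /=.
by rewrite -big_split; apply: eq_bigr => j _ /=; ring.
Qed.

(* The set of pairs satisfying a Poincare inequality contains the edges and is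
   closed under composition, hence contains all connected pairs. *)
Lemma connected_poincare {R : realType} {N : nat} (G : weighted_graph R N) i j :
  connect (edge G) i j -> exists2 C : R, 0 <= C &
    forall w : 'cV[R]_N, (w i 0 - w j 0) ^+ 2 <= C * dirichlet (adj G) w.
Proof.
move=> /connectP[p]; elim: p i => [|k p IH] i /=.
  by move=> _ ->; exists 0 => // w; rewrite subrr expr0n mul0r.
move=> /andP[ik /IH{}IH] /IH[C C0 HC].
have a0 := adj_gt0 ik.
(* From [(p + q)^2 <= 2 p^2 + 2 q^2], with [p] the difference along the first edge and [q] the
   difference along the rest of the path. *)
exists (2 * C + 2 / adj G k i) => [|w].
  by rewrite addr_ge0 ?mulr_ge0 // invr_ge0 ltW.
have E1 : adj G k i * (w k 0 - w i 0) ^+ 2 <= dirichlet (adj G) w.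
  rewrite /dirichlet (bigD1 k) //= (bigD1 i) //= -addrA lerDl.
  rewrite addr_ge0 ?sumr_ge0 // => l _; first exact: dirichlet_term_ge0.
  by rewrite sumr_ge0 // => m _; exact: dirichlet_term_ge0.
have E2 : (w k 0 - w i 0) ^+ 2 <= (adj G k i)^-1 * dirichlet (adj G) w.
  by rewrite mulrC ler_pdivlMr // mulrC.
have := HC w; have := sqr_ge0 (w i 0 - w k 0 - (w k 0 - w j 0)).
rewrite mulrDl; nra.
Qed.

Lemma poincare {R : realType} {N : nat} (G : weighted_graph R N) :
  connected_graph G -> exists2 C : R, 0 < C &
    forall (w : 'cV[R]_N) i j, (w i 0 - w j 0) ^+ 2 <= C * dirichlet (adj G) w.
Proof.
move=> conG; have /all_sig2[C C0 HC] : forall ij : 'I_N * 'I_N,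
    {C : R | 0 <= C & forall w : 'cV[R]_N,
      (w ij.1 0 - w ij.2 0) ^+ 2 <= C * dirichlet (adj G) w}.
  by move=> ij; apply: cid2; exact: connected_poincare.
exists (1 + \sum_ij C ij) => [|w i j]; first by rewrite ltr_pwDl ?sumr_ge0.
apply: le_trans (HC (i, j) w) _; apply: ler_wpM2r.
  by do 2![rewrite sumr_ge0 // => ? _]; exact: dirichlet_term_ge0.
rewrite (bigD1 (i, j)) //=.
have : 0 <= \sum_(k | k != (i, j)) C k by rewrite sumr_ge0.
lra.
Qed.

(** The Poincare inequality gives [c]. The entries of [L w] are linear in the differences [z] and
    the Dirichlet form is quadratic: [|z| <= 1 + z^2] bounds an entry by the form plus the total
    weight [al], and [al] is absorbed because the form is at least [c]. *)
Lemma laplacian_coercive {R : realType} {N : nat} (G : weighted_graph R N)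
    (Delta : R) : connected_graph G -> 0 < Delta -> exists c K : R,
  [/\ 0 < c, 0 < K & forall (w : 'cV[R]_N) i j, Delta <= `|w i 0 - w j 0| ->
    c <= dirichlet (adj G) w /\
    forall k, `|(laplacian G *m w) k 0| <= K * dirichlet (adj G) w].
Proof.
move=> conG D0; have [C C0 HC] := poincare G conG.
pose al := \sum_i \sum_j adj G i j.
have al0 : 0 <= al by do 2![rewrite sumr_ge0 // => ? _]; exact: adj_ge0.
have c0 : 0 < Delta ^+ 2 / C by rewrite divr_gt0 ?exprn_gt0.
exists (Delta ^+ 2 / C), (1 + al / (Delta ^+ 2 / C)); split => // [|w i j Dw].
  by rewrite ltr_pwDl // divr_ge0 // ltW.
have cE : Delta ^+ 2 / C <= dirichlet (adj G) w.
  rewrite ler_pdivrMr // mulrC; apply: le_trans (HC w i j).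
  by rewrite -[leRHS]real_normK ?num_real // lerXn2r ?nnegrE // ltW.
split => // k.
have -> : (1 + al / (Delta ^+ 2 / C)) * dirichlet (adj G) w =
    dirichlet (adj G) w + al * (dirichlet (adj G) w / (Delta ^+ 2 / C)).
  by ring.
apply: (@le_trans _ _ (dirichlet (adj G) w + al)); last first.
  by rewrite lerD2l ler_peMr // ler_pdivlMr // mul1r.
rewrite laplacianE; apply: le_trans (ler_norm_sum _ _ _) _.
rewrite /dirichlet /al -big_split /= [leRHS](bigD1 k) //= -[leLHS]addr0 lerD //.
  rewrite -big_split /= ler_sum // => l _.
  rewrite normrM (ger0_norm (adj_ge0 _ _ _)) -{3}[adj G k l]mulr1 -mulrDr.
  apply: ler_wpM2l; first exact: adj_ge0.
  rewrite -[(w k 0 - w l 0) ^+ 2]real_normK ?num_real //.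
  have := sqr_ge0 (`|w k 0 - w l 0| - 1); nra.
rewrite sumr_ge0 // => l _; rewrite addr_ge0 ?sumr_ge0 // => m _.
  exact: dirichlet_term_ge0.
exact: adj_ge0.
Qed.

(** * The convex potential of the quantizer and its subgradients *)

(** The continuous piecewise affine primitive of the quantizer that vanishes at 0. *)
Definition potential {R : realType} (Delta r : R) : R :=
  quantizer Delta r * r - quantizer Delta r ^+ 2 / 2.

Definition subgradient {R : realType} (f : R -> R) (w x : R) : Prop :=
  forall y, f x + w * (y - x) <= f y.

Lemma quantizer_itv {R : realType} (Delta r : R) : 0 < Delta ->
  quantizer Delta r - Delta / 2 <= r < quantizer Delta r + Delta / 2.
Proof.
move=> D0; rewrite /quantizer; set k := Num.floor _.
have rE : r = r / Delta * Delta by rewrite divfK ?gt_eqF.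
have /andP[] := floor_itv (r / Delta + 1 / 2); rewrite -/k intrD => k1 k2.
by rewrite [X in _ <= X < _]rE; apply/andP; split; nra.
Qed.

Lemma quantizer_eq {R : realType} (Delta r : R) (k : int) : 0 < Delta ->
  k%:~R * Delta - Delta / 2 <= r < k%:~R * Delta + Delta / 2 ->
  quantizer Delta r = k%:~R * Delta.
Proof.
move=> D0 /andP[k1 k2]; rewrite /quantizer; congr (_%:~R * _).
apply/eqP; rewrite floor_eq intrD mulr1z -lerBlDr -ltrBrDr.
rewrite ler_pdivlMr // ltr_pdivrMr //; apply/andP; split; lra.
Qed.

(* [potential] is the maximum of the affine functions [r |-> a r - a^2 / 2],
   where [a] ranges over the quantization levels. *)
Lemma potential_max {R : realType} (Delta r : R) (k : int) : 0 < Delta ->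
  k%:~R * Delta * r - (k%:~R * Delta) ^+ 2 / 2 <= potential Delta r.
Proof.
move=> D0; rewrite /potential; have := quantizer_itv Delta r D0.
rewrite /quantizer; set j := Num.floor _.
set u := j%:~R * Delta; set v := k%:~R * Delta => /andP[ru1 ru2].
(* The right side minus the left is [(u - v) (r - (u + v) / 2)]. Distinct levels are at least
   [Delta] apart and [r] is within [Delta / 2] of [u], so [r] is on the side of [u] of the
   midpoint. *)
have [jk|kj|jk] := ltgtP j k; last by rewrite /u /v jk.
- have uv : u + Delta <= v.
    have : ((j + 1)%:~R : R) <= k%:~R by rewrite ler_int lezD1.
    rewrite intrD => H; rewrite /u /v.
    have : (j%:~R + 1) * Delta <= k%:~R * Delta by rewrite ler_pM2r.
    lra.
  nra.
- have vu : v + Delta <= u.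
    have : ((k + 1)%:~R : R) <= j%:~R by rewrite ler_int lezD1.
    rewrite intrD => H; rewrite /u /v.
    have : (k%:~R + 1) * Delta <= j%:~R * Delta by rewrite ler_pM2r.
    lra.
  nra.
Qed.

Lemma potential_ge0 {R : realType} (Delta r : R) : 0 < Delta ->
  0 <= potential Delta r.
Proof. by move=> /(potential_max _ r 0); rewrite !mul0r expr0n mul0r subr0. Qed.

Lemma potential_ge {R : realType} (Delta r s : R) : 0 < Delta ->
  quantizer Delta s * r - quantizer Delta s ^+ 2 / 2 <= potential Delta r.
Proof. exact: potential_max. Qed.

Lemma subgradient_quantizer {R : realType} (Delta r : R) : 0 < Delta ->
  subgradient (potential Delta) (quantizer Delta r) r.
Proof.
move=> D0 y; apply: le_trans (potential_ge Delta y r D0).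
rewrite /potential; lra.
Qed.

(** Near [r] the quantizer takes the level of [r] and, if [r] is a jump, also the level just below;
    the affine functions of both attain the maximum at [r]. *)
Lemma subgradient_quantizer_near {R : realType} (Delta r : R) : 0 < Delta ->
  exists2 d : R, 0 < d & forall y, `|y - r| < d ->
    subgradient (potential Delta) (quantizer Delta y) r.
Proof.
move=> D0; have /andP[r1 r2] := quantizer_itv Delta r D0.
suff [d d0 Hd] : exists2 d : R, 0 < d & forall y, `|y - r| < d ->
    potential Delta r <=
    quantizer Delta y * r - quantizer Delta y ^+ 2 / 2.
  exists d => // y /Hd{}Hd z; apply: le_trans (potential_ge Delta z y D0).
  lra.
move: r1; rewrite le_eqVlt => /orP[/eqP r1|r1].
  exists (Delta / 2) => [|y]; first by rewrite divr_gt0.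
  rewrite ltr_norml => /andP[y1 y2]; rewrite /potential.
  have [ry|yr] := leP r y.
    rewrite (quantizer_eq Delta y (Num.floor (r / Delta + 1 / 2))) //.
    by rewrite -/(quantizer Delta r); apply/andP; split; lra.
  have -> : quantizer Delta y = quantizer Delta r - Delta.
    rewrite (quantizer_eq Delta y (Num.floor (r / Delta + 1 / 2) - 1)) //.
      by rewrite /quantizer intrB mulrBl mulr1z [1 * Delta]mul1r.
    rewrite intrB mulrBl mulr1z [1 * Delta]mul1r -/(quantizer Delta r).
    by apply/andP; split; lra.
  have : Delta * (quantizer Delta r - Delta / 2 - r) = 0.
    by rewrite r1 subrr mulr0.
  lra.
pose d := Num.min (r - (quantizer Delta r - Delta / 2))
                  (quantizer Delta r + Delta / 2 - r).
exists d => [|y]; first by rewrite /d lt_min; apply/andP; split; lra.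
rewrite /d lt_min !ltr_norml => /andP[/andP[y1 y2] /andP[y3 y4]].
rewrite (quantizer_eq Delta y (Num.floor (r / Delta + 1 / 2))) //.
by rewrite -/(quantizer Delta r); apply/andP; split; lra.
Qed.

(** Subgradients are monotone: a point [y > r] inside the cell of level [k] would have a subgradient
    below [w]. With its mirror image below, this locates [r] from [w]. *)
Lemma subgradient_gt_level {R : realType} (Delta w r : R) (k : int) :
  0 < Delta -> subgradient (potential Delta) w r -> k%:~R * Delta < w ->
  k%:~R * Delta + Delta / 2 <= r.
Proof.
move=> D0 Hw kw; rewrite leNgt; apply/negP => rk.
(* The midpoint between the right end of the cell and the larger of [r] and the left end. *)
pose y := (Num.max r (k%:~R * Delta - Delta / 2) +
           (k%:~R * Delta + Delta / 2)) / 2.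
have m1 : r <= Num.max r (k%:~R * Delta - Delta / 2) by rewrite le_max lexx.
have m2 : k%:~R * Delta - Delta / 2 <= Num.max r (k%:~R * Delta - Delta / 2).
  by rewrite le_max lexx orbT.
have m3 : Num.max r (k%:~R * Delta - Delta / 2) < k%:~R * Delta + Delta / 2.
  by rewrite gt_max rk /=; lra.
have ry : r < y by rewrite /y; lra.
have qy : quantizer Delta y = k%:~R * Delta.
  by apply: quantizer_eq => //; rewrite /y; apply/andP; split; lra.
have := Hw y; have := subgradient_quantizer Delta y D0 r.
rewrite qy; nra.
Qed.

Lemma subgradient_lt_level {R : realType} (Delta w r : R) (k : int) :
  0 < Delta -> subgradient (potential Delta) w r -> w < k%:~R * Delta ->
  r <= k%:~R * Delta - Delta / 2.
Proof.
move=> D0 Hw kw; rewrite leNgt; apply/negP => rk.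
pose y := (Num.min r (k%:~R * Delta + Delta / 2) +
           (k%:~R * Delta - Delta / 2)) / 2.
have m1 : Num.min r (k%:~R * Delta + Delta / 2) <= r by rewrite ge_min lexx.
have m2 : Num.min r (k%:~R * Delta + Delta / 2) <= k%:~R * Delta + Delta / 2.
  by rewrite ge_min lexx orbT.
have m3 : k%:~R * Delta - Delta / 2 < Num.min r (k%:~R * Delta + Delta / 2).
  by rewrite lt_min rk /=; lra.
have ry : y < r by rewrite /y; lra.
have qy : quantizer Delta y = k%:~R * Delta.
  by apply: quantizer_eq => //; rewrite /y; apply/andP; split; lra.
have := Hw y; have := subgradient_quantizer Delta y D0 r.
rewrite qy; nra.
Qed.

(** The bound is uniform in [w], so that a tolerance can be fixed before the subgradient is
    known. *)
Lemma subgradient_bound {R : realType} (f : R -> R) (w x : R) :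
  subgradient f w x -> `|w| <= `|f (x + 1) - f x| + `|f (x - 1) - f x|.
Proof.
move=> Hw; have := Hw (x + 1); have := Hw (x - 1).
rewrite [x + 1]addrC [x - 1]addrC !addrK mulr1 mulrN1 => H1 H2.
have := ler_norm (f (1 + x) - f x); have := ler_norm (f (- 1 + x) - f x).
have := normr_ge0 (f (1 + x) - f x); have := normr_ge0 (f (- 1 + x) - f x).
by move=> *; rewrite ler_norml; apply/andP; split; lra.
Qed.

Lemma potential_lipschitz {R : realType} (Delta M y z : R) : 0 < Delta ->
  `|y| <= M -> `|z| <= M ->
  `|potential Delta y - potential Delta z| <= (M + Delta) * `|y - z|.
Proof.
move=> D0.
suff H u v : `|u| <= M ->
    potential Delta u - potential Delta v <= (M + Delta) * `|u - v|.
  by move=> /H Hy /H Hz; rewrite ler_norml lerNl opprB Hy distrC Hz.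
move=> uM; have uv := subgradient_quantizer Delta u D0 v.
apply: (@le_trans _ _ (quantizer Delta u * (u - v))); first lra.
apply: le_trans (ler_norm _) _; rewrite normrM ler_wpM2r //.
have := quantizer_itv Delta u D0; move: uM; rewrite !ler_norml.
by move=> /andP[? ?] /andP[? ?]; apply/andP; split; lra.
Qed.

(** * Subgradients at a state, the consensus set and Krasowskii velocities *)

Definition subgradients {R : realType} {N : nat} (f : R -> R)
    (x : 'cV[R]_N) : set 'cV[R]_N :=
  [set w | forall i, subgradient f (w i 0) (x i 0)].

(* The closure of [quantized_consensus]. *)
Definition flat {R : realType} {N : nat} (Delta : R) (x : 'cV[R]_N) : Prop :=
  exists k : int, forall i,
    k%:~R * Delta - Delta / 2 <= x i 0 <= k%:~R * Delta + Delta / 2.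

Lemma entry_le_enorm {R : realType} {N : nat} (v : 'cV[R]_N) i :
  `|v i 0| <= enorm v.
Proof.
rewrite -sqrtr_sqr /enorm ler_sqrt; last first.
  by rewrite sumr_ge0 // => j _; exact: sqr_ge0.
by rewrite (bigD1 i) //= lerDl sumr_ge0 // => j _; exact: sqr_ge0.
Qed.

(** The crude factor [N.+1] is positive even for [N = 0], so it can be divided by later. *)
Lemma enorm_le {R : realType} {N : nat} (v : 'cV[R]_N) (m : R) : 0 <= m ->
  (forall i, `|v i 0| <= m) -> enorm v <= N.+1%:R * m.
Proof.
move=> m0 vm; rewrite /enorm -[leRHS]ger0_norm ?mulr_ge0 // -sqrtr_sqr.
rewrite ler_sqrt ?sqr_ge0 // (@le_trans _ _ (\sum_(i < N) m ^+ 2)) //.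
  apply: ler_sum => i _.
  by rewrite -[leLHS]real_normK ?num_real // lerXn2r ?nnegrE.
rewrite sumr_const card_ord -[leLHS]mulr_natl exprMn ler_wpM2r ?sqr_ge0 //.
rewrite -natrX ler_nat.
exact: leq_trans (leqnSn N) (@leq_pexp2l N.+1 1 2 isT isT).
Qed.

Lemma edistance_flat {R : realType} {N : nat} (Delta e : R) (x y : 'cV[R]_N) :
  0 < Delta -> 0 < e -> flat Delta y -> (forall i, `|x i 0 - y i 0| <= e) ->
  0 <= edistance x (quantized_consensus Delta) <= N.+1%:R * (e + e).
Proof.
move=> D0 e0 [k yk] xy; pose h := Num.min e (Delta / 2).
have [h0 he hD] : [/\ 0 < h, h <= e & h <= Delta / 2].
  by rewrite /h lt_min !ge_min !lexx orbT e0 divr_gt0.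
(* The upper end of a closed cell quantizes to the next level: capping the entries [h] below it
   enters the consensus set and moves them by at most [h <= e]. *)
pose z : 'cV[R]_N := \col_i Num.min (y i 0) (k%:~R * Delta + Delta / 2 - h).
have zD : quantized_consensus Delta z.
  exists k => i; rewrite mulrC; apply: quantizer_eq => //; rewrite !mxE.
  have /andP[y1 y2] := yk i; rewrite le_min gt_min y1 /=.
  by apply/andP; split; [lra | apply/orP; right; lra].
have lb : lbound [set enorm (x - y) | y in quantized_consensus Delta] 0.
  by move=> _ [u _ <-]; exact: sqrtr_ge0.
apply/andP; split; first by apply: lb_le_inf => //; exists (enorm (x - z)), z.
apply: (@le_trans _ _ (enorm (x - z))).
  by apply: ge_inf; [exists 0 | exists z].
apply: enorm_le => [|i]; first by rewrite addr_ge0 // ltW.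
rewrite !mxE; have := xy i; have /andP[y1 y2] := yk i.
rewrite !ler_norml => /andP[? ?].
by case: (leP (y i 0)) => ?; apply/andP; split; lra.
Qed.

(** If [k] is the ceiling of the least entry of [w] divided by [Delta], all entries lie strictly
    between levels [k - 1] and [k + 1], which confines [x] to the closed cell [k]. The case [N = 0],
    without a least entry, is vacuous. *)
Lemma subgradients_close_flat {R : realType} {N : nat} (Delta : R)
    (x w : 'cV[R]_N) : 0 < Delta -> subgradients (potential Delta) x w ->
  (forall i j, `|w i 0 - w j 0| < Delta) -> flat Delta x.
Proof.
move=> D0 wx wD; have [i0|noi] := pselect (exists i0 : 'I_N, True); last first.
  by exists 0 => i; exfalso; apply: noi; exists i.
have [m wm] : exists m, forall i, w m 0 <= w i 0.
  have [i0' _] := i0; exists [arg min_(i < i0') w i 0]%O => i.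
  by case: arg_minP => // j _ /(_ i isT).
pose k := Num.ceil (w m 0 / Delta).
have /andP[] := ceil_itv (w m 0 / Delta); rewrite -/k intrB mulr1z.
rewrite ltr_pdivlMr // ler_pdivrMr // => k1 k2.
exists k => i; apply/andP; split.
  have := subgradient_gt_level Delta (w i 0) (x i 0) (k - 1) D0 (wx i).
  rewrite intrB mulr1z mulrBl mul1r => H.
  have : k%:~R * Delta - Delta < w i 0 by have := wm i; lra.
  by move=> /H; lra.
have := subgradient_lt_level Delta (w i 0) (x i 0) (k + 1) D0 (wx i).
rewrite intrD mulr1z mulrDl mul1r => H.
have : w i 0 < k%:~R * Delta + Delta.
  by have := wD i m; rewrite ltr_norml => /andP[_ ?]; lra.
by move=> /H; lra.
Qed.

(* The quantized values near [x] are subgradients at [x], and the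
   subdifferential is convex: taking convex hulls stays in its image. *)
Lemma krasowskii_subgradients {R : realType} {N : nat} (Delta e : R)
    (L : 'M[R]_N) (x v : 'cV[R]_N) : 0 < Delta -> 0 < e ->
  krasowskii (fun y => - L *m quantize Delta y) x v ->
  exists2 w, subgradients (potential Delta) x w &
    forall i, `|v i 0 + (L *m w) i 0| < e.
Proof.
move=> D0 e0 Kv.
have /all_sig2[r r0 Hr] : forall i : 'I_N, {d : R | 0 < d &
    forall y, `|y - x i 0| < d ->
      subgradient (potential Delta) (quantizer Delta y) (x i 0)}.
  by move=> i; apply: cid2; exact: subgradient_quantizer_near.
(* A radius common to all entries; the default 1 keeps it positive when [N = 0]. *)
pose d := \big[Num.min/1]_i r i.
have d0 : 0 < d by rewrite /d; apply: lt_bigmin.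
pose S := [set - L *m w | w in subgradients (potential Delta) x].
have /(_ S) Kd := @smallest_sub _ (@convex_set R 'cV[R]_N)
  ((fun y => - L *m quantize Delta y) @` eball x d).
have /Kv : [set d : R | 0 < d] d by [].
have hullS :
    convex_hull ((fun y => - L *m quantize Delta y) @` eball x d) `<=` S.
  apply: Kd => [u1 u2 l|_ [y yd <-]].
    rewrite !inE => -[w1 w1x <-] [w2 w2x <-].
    exists (l%:num *: w1 + (1 - l%:num) *: w2).
      move=> i y; rewrite !mxE.
      have := w1x i y; have := w2x i y.
      have l0 : 0 <= l%:num by [].
      have l1 : l%:num <= 1 by [].
      nra.
    by rewrite mulmxDr -!scalemxAr.
  exists (quantize Delta y) => // i; rewrite !mxE; apply: Hr.
  apply: lt_le_trans (bigmin_le _ i r); apply: le_lt_trans yd.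
  by apply: le_trans (entry_le_enorm _ i); rewrite !mxE.
(* [v] is in the closure of [S], hence within [e] of some [- L w] in [S]. *)
move=> /(closure_subset hullS) /(_ (ball v e)).
have /[swap]/[apply] : nbhs v (ball v e) by exact: nbhsx_ballx.
move=> [_ [[w wx <-] [_ Hb]]]; exists w => // i.
by have := Hb i 0; rewrite /ball /= mulNmx !mxE opprK.
Qed.

Lemma derive_left {R : realType} {N : nat} (x : R -> 'cV[R]_N) (t e : R) :
  derivable x t 1 -> 0 < e -> exists2 d : R, 0 < d & forall s, t - d < s ->
    s < t -> forall i, `|x t i 0 - x s i 0 - (derive x t 1) i 0 * (t - s)|
      <= e * (t - s).
Proof.
move=> dx e0; have /cvg_ballP/(_ e e0) : h^-1 *: ((x \o shift t) (h *: 1) - x t)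
    @[h --> 0^'] --> derive x t 1 by exact: dx.
move=> /nbhs_ballP[d /= d0 Hd]; exists d => // s ds st i.
have st0 : s - t < 0 by lra.
have := Hd (s - t); rewrite /ball /= sub0r normrN ltr0_norm // => /(_ _)[||_].
- lra.
- exact: ltr0_neq0.
move=> /(_ i 0); rewrite /ball /= !mxE /shift /= -[(s - t) *: 1]/((s - t) * 1).
rewrite mulr1 subrK => H.
have -> : x t i 0 - x s i 0 - (derive x t 1) i 0 * (t - s) =
   ((derive x t 1) i 0 - (s - t)^-1 * (x s i 0 - x t i 0)) * (s - t).
  by field; exact: ltr0_neq0.
rewrite normrM (ltr0_norm st0) opprB ler_wpM2r //; lra.
Qed.

(** * Decrease of tilted Lyapunov functions along a solution *)

Section Evolution.
Context {R : realType} {N : nat}.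
Context (G : weighted_graph R N) (Delta : R) (x : R -> 'cV[R]_N).
Context (symG : symmetric_graph G) (D0 : 0 < Delta).

Let f (y : 'cV[R]_N) := - laplacian G *m quantize Delta y.
Let E (w : 'cV[R]_N) := dirichlet (adj G) w.

(** The linear tilt [p] and the drift [c] let one monotonicity result give the decay of [V], its
    linear rate and the bound on the distance travelled. *)
Definition lyapunov (p : 'cV[R]_N) (c t : R) : R :=
  \sum_i (potential Delta (x t i 0) + p i 0 * x t i 0) + c * t.

(* Convexity bounds increments of the potential from above only on the left of
   [t], where they pair with a subgradient at [x t]. *)
Lemma lyapunov_left (p : 'cV[R]_N) (c t : R) :
  derivable x t 1 -> krasowskii f (x t) (derive x t 1) ->
  (forall w, subgradients (potential Delta) (x t) w ->
    c <= E w / 2 + \sum_i p i 0 * (laplacian G *m w) i 0) ->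
  forall e, 0 < e -> exists2 d : R, 0 < d & forall s, s < t -> t - d < s ->
    lyapunov p c t - lyapunov p c s <= e * (t - s).
Proof.
move=> dx Kx Hc e e0.
pose b i := `|potential Delta (x t i 0 + 1) - potential Delta (x t i 0)| +
            `|potential Delta (x t i 0 - 1) - potential Delta (x t i 0)|.
pose B := \sum_i (b i + `|p i 0|).
have b0 i : 0 <= b i by rewrite /b addr_ge0.
have B0 : 0 <= B by rewrite sumr_ge0 // => i _; rewrite addr_ge0.
(* Each entry errs by at most [2 * e1] per unit of time, once for the difference quotient and once
   for the velocity against [- L w]; these errors are weighted by [B] in total. *)
pose e1 := e / (2 * (B + 1)).
have e10 : 0 < e1 by rewrite divr_gt0 // mulr_gt0 //; lra.
have [w wx Hw] := krasowskii_subgradients Delta e1 _ _ _ D0 e10 Kx.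
have [d d0 Hd] := derive_left x t e1 dx e10.
exists d => // s st ds.
set Lw := laplacian G *m w in Hw *.
have T0 : 0 <= t - s by lra.
have step i : (potential Delta (x t i 0) + p i 0 * x t i 0) -
    (potential Delta (x s i 0) + p i 0 * x s i 0) <=
    - (w i 0 * Lw i 0 + p i 0 * Lw i 0) * (t - s) +
    (b i + `|p i 0|) * (2 * e1 * (t - s)).
  have H1 := wx i (x s i 0).
  have H2 : `|x t i 0 - x s i 0 + Lw i 0 * (t - s)| <= 2 * e1 * (t - s).
    have -> : x t i 0 - x s i 0 + Lw i 0 * (t - s) =
      (x t i 0 - x s i 0 - (derive x t 1) i 0 * (t - s)) +
      ((derive x t 1) i 0 + Lw i 0) * (t - s) by ring.
    apply: le_trans (ler_normD _ _) _; have := Hd s ds st i.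
    have : `|((derive x t 1) i 0 + Lw i 0) * (t - s)| <= e1 * (t - s).
      by rewrite normrM (ger0_norm T0) ler_wpM2r // ltW.
    lra.
  have H3 : (w i 0 + p i 0) * (x t i 0 - x s i 0 + Lw i 0 * (t - s)) <=
      (b i + `|p i 0|) * (2 * e1 * (t - s)).
    apply: le_trans (ler_norm _) _; rewrite normrM; apply: ler_pM => //.
    apply: le_trans (ler_normD _ _) _; rewrite lerD2r.
    exact: subgradient_bound (wx i).
  lra.
have Q := laplacian_quadratic G w symG; rewrite -/Lw -/(E w) in Q.
have := Hc w wx; rewrite -/Lw => Hcw.
have sumle : \sum_i (potential Delta (x t i 0) + p i 0 * x t i 0) -
    \sum_i (potential Delta (x s i 0) + p i 0 * x s i 0) <=
    - (E w / 2 + \sum_i p i 0 * Lw i 0) * (t - s) + B * (2 * e1 * (t - s)).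
  rewrite -sumrB; apply: le_trans (ler_sum _ (fun i _ => step i)) _.
  by rewrite big_split /= -!mulr_suml sumrN big_split /= Q.
have eB : B * (2 * e1) <= e.
  have -> : B * (2 * e1) = e * (B / (B + 1)) by rewrite /e1; field; lra.
  by rewrite ler_piMr ?(ltW e0) // ler_pdivrMr //; lra.
rewrite /lyapunov.
have : B * (2 * e1) * (t - s) <= e * (t - s) by rewrite ler_wpM2r.
have : c * (t - s) <= (E w / 2 + \sum_i p i 0 * Lw i 0) * (t - s).
  by rewrite ler_wpM2r.
lra.
Qed.

Lemma abs_continuous_entry_unif (a b : R) : abs_continuous a b x ->
  forall e : R, 0 < e -> exists2 d : R, 0 < d & forall s t, a <= s -> s <= t ->
    t <= b -> t - s < d -> forall i, `|x t i 0 - x s i 0| < e.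
Proof.
move=> acx e e0; have [d d0 H] := acx e e0; exists d => // s t as_ st tb std i.
apply: (@le_lt_trans _ _ (enorm (x t - x s))).
  by apply: le_trans (entry_le_enorm _ i); rewrite !mxE.
have := H 1%N (fun=> s) (fun=> t); rewrite !big_ord1; apply => //.
by move=> j k _ _ _; rewrite !ord1.
Qed.

(** Going from [a] in steps of length [d / 2], each entry changes by less than 1 per step. *)
Lemma abs_continuous_bounded (a b : R) : a <= b -> abs_continuous a b x ->
  exists M : R, forall t, a <= t <= b -> forall i, `|x t i 0| <= M.
Proof.
move=> ab acx; have [d d0 H] := abs_continuous_entry_unif a b acx 1 ltr01.
have bound n t : a <= t <= b -> t <= a + n%:R * (d / 2) ->
    forall i, `|x t i 0| <= \sum_i `|x a i 0| + n%:R.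
  elim: n t => [|n IH] t /andP[at_ tb] tn i.
    have -> : t = a.
      apply/eqP; rewrite eq_le at_ andbT.
      by rewrite -[a]addr0 -[X in _ + X](mul0r (d / 2)).
    by rewrite addr0 (bigD1 i) //= lerDl sumr_ge0.
  pose s := Num.max a (t - d / 2).
  have as_ : a <= s by rewrite /s le_max lexx.
  have st : s <= t by rewrite /s ge_max at_ /=; lra.
  have ts : t - d / 2 <= s by rewrite /s le_max lexx orbT.
  have sn : s <= a + n%:R * (d / 2).
    rewrite /s ge_max; apply/andP; split.
      by rewrite lerDl mulr_ge0 // divr_ge0 // ltW.
    by move: tn; rewrite -(natr1 n) mulrDl mul1r addrA -lerBlDr.
  have sab : a <= s <= b by rewrite as_ (le_trans st).
  have := IH s sab sn i; have std : t - s < d by lra.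
  have := H s t as_ st tb std i.
  have := ler_normD (x t i 0 - x s i 0) (x s i 0); rewrite subrK -natr1; lra.
pose n := Num.bound ((b - a) / (d / 2)).
exists (\sum_i `|x a i 0| + n%:R) => t tab; apply: bound => //.
have : (b - a) / (d / 2) < n%:R.
  by apply: archi_boundP; rewrite divr_ge0 ?divr_ge0 ?(ltW d0) // subr_ge0.
rewrite ltr_pdivrMr ?divr_gt0 //; move/andP: tab => [_]; lra.
Qed.

(** On the bounded range of [x] the potential is Lipschitz, so increments are at most [C] times the
    displacement plus the elapsed time. *)
Lemma lyapunov_abs_continuous (p : 'cV[R]_N) (c a b : R) : a <= b ->
  abs_continuous a b x -> real_abs_continuous a b (lyapunov p c).
Proof.
move=> ab acx; have [M HM] := abs_continuous_bounded a b ab acx.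
pose C := \sum_i (`|M| + Delta + `|p i 0|) + `|c| + 1.
have S0 : 0 <= \sum_i (`|M| + Delta + `|p i 0|).
  by rewrite sumr_ge0 // => i _; rewrite !addr_ge0 // ltW.
have C0 : 0 < C by rewrite /C ltr_wpDl // addr_ge0.
have lip s t : a <= s -> s <= t -> t <= b ->
    `|lyapunov p c t - lyapunov p c s| <= C * (enorm (x t - x s) + (t - s)).
  move=> as_ st tb; rewrite /lyapunov opprD addrACA -sumrB -mulrBr.
  apply: le_trans (ler_normD _ _) _.
  have ts0 : 0 <= t - s by rewrite subr_ge0.
  have En0 : 0 <= enorm (x t - x s) by exact: sqrtr_ge0.
  have -> : C * (enorm (x t - x s) + (t - s)) =
     \sum_i (`|M| + Delta + `|p i 0|) * enorm (x t - x s) + `|c| * (t - s) +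
     (\sum_i (`|M| + Delta + `|p i 0|) * (t - s) + `|c| * enorm (x t - x s) +
     (enorm (x t - x s) + (t - s))) by rewrite /C -!mulr_suml; ring.
  apply: (@le_trans _ _ (\sum_i (`|M| + Delta + `|p i 0|) * enorm (x t - x s)
                         + `|c| * (t - s))); last first.
    have := mulr_ge0 S0 ts0; have := mulr_ge0 (normr_ge0 c) En0.
    by rewrite lerDl -mulr_suml; lra.
  rewrite normrM (ger0_norm ts0).
  rewrite lerD2r; apply: le_trans (ler_norm_sum _ _ _) _.
  apply: ler_sum => i _.
  have xs : `|x s i 0| <= `|M|.
    by apply: le_trans (HM s _ i) (ler_norm _); rewrite as_ (le_trans st).
  have xt : `|x t i 0| <= `|M|.
    by apply: le_trans (HM t _ i) (ler_norm _); rewrite tb (le_trans as_).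
  have := potential_lipschitz Delta _ _ _ D0 xt xs.
  have xi : `|x t i 0 - x s i 0| <= enorm (x t - x s).
    by apply: le_trans (entry_le_enorm _ i); rewrite !mxE.
  move=> H; rewrite [X in `|X|](_ : _ =
    (potential Delta (x t i 0) - potential Delta (x s i 0)) +
    p i 0 * (x t i 0 - x s i 0)); last by ring.
  apply: le_trans (ler_normD _ _) _; rewrite [leRHS]mulrDl lerD //.
    by apply: le_trans H _; rewrite ler_wpM2l // addr_ge0 // ltW.
  by rewrite normrM ler_wpM2l.
move=> e e0; have e1 : 0 < e / (2 * C) by rewrite divr_gt0 // mulr_gt0.
have [d d0 Hd] := acx _ e1.
exists (Num.min d (e / (2 * C))) => [|n s t st tr]; first by rewrite lt_min d0.
rewrite lt_min => /andP[sd se].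
apply: (@le_lt_trans _ _
  (\sum_(i < n) C * (enorm (x (t i) - x (s i)) + (t i - s i)))).
  by apply: ler_sum => i _; have [? ? ?] := st i; exact: lip.
rewrite -mulr_sumr big_split /= [ltRHS](_ : _ =
  C * (e / (2 * C) + e / (2 * C))); last by field; exact: lt0r_neq0.
by rewrite ltr_pM2l // ltrD // Hd.
Qed.

Context (solx : krasowskii_solution f x).

(** The rate condition ranges over all subgradients, since the velocity is matched by one only up to
    a tolerance. *)
Lemma lyapunov_nonincreasing (p : 'cV[R]_N) (c a b : R) : 0 <= a -> a <= b ->
  (forall t w, a <= t <= b -> subgradients (potential Delta) (x t) w ->
    c <= E w / 2 + \sum_i p i 0 * (laplacian G *m w) i 0) ->
  lyapunov p c b <= lyapunov p c a.
Proof.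
move=> a0 ab Hc; have [acx aex] := solx.
apply: abs_continuous_nonincreasing => //.
  by apply: lyapunov_abs_continuous => //; exact: acx.
apply: filterS aex; first exact: (ae_filter_ringOfSetsType lebesgue_measure).
move=> t Ht tab e e0.
have [|dx Kx] := Ht; first by case/andP: tab => /(le_trans a0).
have [d d0 Hd] := lyapunov_left p c t dx Kx (fun w => Hc t w tab) e e0.
by exists d => // s _ st ds; exact: Hd.
Qed.

End Evolution.

(** * Convergence to the consensus set *)

Theorem theorem2 (R : realType) (N : nat) (G : weighted_graph R N)
    (Delta : R) (x : R -> 'cV[R]_N) :
  connected_graph G ->
  symmetric_graph G ->
  0 < Delta ->
  krasowskii_solution (fun y => - laplacian G *m quantize Delta y) x ->
  edistance (x t) (quantized_consensus Delta) @[t --> +oo] --> (0 : R).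
Proof.
move=> conG symG D0 solx.
have [c [K [c0 K0 coer]]] := laplacian_coercive G Delta conG D0.
have outside y w : ~ flat Delta y -> subgradients (potential Delta) y w ->
    c <= dirichlet (adj G) w /\
    forall k, `|(laplacian G *m w) k 0| <= K * dirichlet (adj G) w.
  move=> nfl wy.
  have [close|] := pselect (forall i j, `|w i 0 - w j 0| < Delta).
    by case: nfl; exact: subgradients_close_flat close.
  by move=> /existsNP[i /existsNP[j /negP]]; rewrite -leNgt => /coer.
pose V t := \sum_i potential Delta (x t i 0).
have lyapunovE p s t : lyapunov Delta x p s t =
    V t + \sum_i p i 0 * x t i 0 + s * t.
  by rewrite /lyapunov big_split.
have decr := lyapunov_nonincreasing G Delta x symG D0 solx.
have V0 t : 0 <= V t by rewrite sumr_ge0 // => i _; exact: potential_ge0.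
have Vdecr s t : 0 <= s -> s <= t -> V t <= V s.
  move=> s0 st.
  have /(_ 0 0) := decr _ _ s t s0 st.
  rewrite !lyapunovE !mul0r !addr0; rewrite !big1 ?addr0; first last.
  - by move=> i _; rewrite mxE mul0r.
  - by move=> i _; rewrite mxE mul0r.
  apply=> u w _ _; rewrite big1 ?addr0 => [|i _]; last by rewrite mxE mul0r.
  by rewrite divr_ge0 // !sumr_ge0 // => i _; rewrite sumr_ge0 // => j _;
    exact: dirichlet_term_ge0.
(* No tilt and drift [c / 2]: outside the flat set the dissipation is at least [c / 2]. *)
have Vdecr_lin s t : 0 <= s -> s <= t ->
    (forall u, s <= u <= t -> ~ flat Delta (x u)) ->
    V t + c / 2 * t <= V s + c / 2 * s.
  move=> s0 st out.
  have /(_ 0 (c / 2)) := decr _ _ s t s0 st.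
  rewrite !lyapunovE !big1 ?addr0; first last.
  - by move=> i _; rewrite mxE mul0r.
  - by move=> i _; rewrite mxE mul0r.
  apply=> u w /out/outside/[apply] -[cE _].
  rewrite big1 ?addr0 => [|i _]; last by rewrite mxE mul0r.
  by rewrite ler_pM2r // invr_gt0.
have travel s t i : 0 <= s -> s <= t ->
    (forall u, s <= u <= t -> ~ flat Delta (x u)) ->
    `|x t i 0 - x s i 0| <= 2 * K * (V s - V t).
  move=> s0 st out; have K20 : 0 < 2 * K by rewrite mulr_gt0.
  (* Tilting by plus or minus the [i]-th coordinate over [2 * K] is dominated by the dissipation, so
     both tilted functions are nonincreasing. *)
  have H (r : R) : `|r| = 1 ->
      V t + r / (2 * K) * x t i 0 <= V s + r / (2 * K) * x s i 0.
    move=> r1; pose p : 'cV[R]_N := r / (2 * K) *: delta_mx i 0.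
    have pE (y : 'cV[R]_N) : \sum_j p j 0 * y j 0 = r / (2 * K) * y i 0.
      rewrite (bigD1 i) //= !mxE !eqxx mulr1 big1 ?addr0 // => j ji.
      by rewrite !mxE (negbTE ji) mulr0 mul0r.
    have /(_ p 0) := decr _ _ s t s0 st.
    rewrite !lyapunovE !mul0r !addr0 !pE.
    apply=> u w /out/outside/[apply] -[_ LK].
    rewrite pE.
    have : `|r / (2 * K) * (laplacian G *m w) i 0| <= dirichlet (adj G) w / 2.
      rewrite !normrM r1 mul1r gtr0_norm ?invr_gt0 // mulrC ler_pdivrMr //.
      by have := LK i; lra.
    by rewrite ler_norml => /andP[? _]; lra.
  have H1 := H 1 (normr1 _); have H2 := H (- 1) (normrN1 _).
  by rewrite -ler_pdivrMl //; case: (ger0P (x t i 0 - x s i 0)) => _; lra.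
apply/cvgrPdist_lt => e e0.
pose e1 := e / (4 * N.+1%:R).
have e10 : 0 < e1 by rewrite divr_gt0 // mulr_gt0.
have hV : has_inf [set V t | t in [set t | 0 <= t]].
  by split; [exists (V 0), 0 => /= | exists 0 => _ [t _ <-]].
have d0 : 0 < e1 / (4 * K) by rewrite divr_gt0 // mulr_gt0.
(* After [t0], [V] can drop by at most [e1 / (4 * K)], so each entry moves at most [e1 / 2] while
   [x] stays outside the flat set. *)
have [_ [t0 /= t00 <-]] := inf_adherent d0 hV.
set ell := inf _ => Vt0.
have Vell t : 0 <= t -> ell <= V t.
  by move=> t_ge0; apply: ge_inf; [case: hV | exists t].
exists t0; split; [exact: num_real|] => T t0T.
have T0 : 0 <= T by lra.
suff [y fy xy] : exists2 y, flat Delta y & forall i, `|x T i 0 - y i 0| <= e1.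
  have /andP[dge0 dle] := edistance_flat Delta e1 (x T) y D0 e10 fy xy.
  rewrite sub0r normrN ger0_norm //; apply: le_lt_trans dle _.
  have -> : N.+1%:R * (e1 + e1) = e / 2.
    rewrite /e1; have : N.+1%:R != 0 :> R by rewrite pnatr_eq0.
    by move: (N.+1%:R : R) => n n0; field.
  lra.
apply: contrapT => far.
(* Otherwise let [tau] be the infimum of the hitting times: [travel] up to some [s] just before
   [tau], then continuity up to a hitting time [v] just after, cost at most [e1 / 2 + e1 / 4] per
   entry. *)
have never t : T <= t -> ~ flat Delta (x t).
  move=> Tt ft; apply: far.
  pose S := [set t | T <= t /\ flat Delta (x t)].
  have hS : has_inf S by split; [exists t | exists T => u []].
  pose tau := inf S.
  have Ttau : T <= tau by apply: lb_le_inf => [|u []//]; exists t.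
  have before u : T <= u -> u < tau -> ~ flat Delta (x u).
    move=> Tu ut fu; have : tau <= u by apply: ge_inf; [case: hS | split].
    by rewrite leNgt ut.
  have [acx _] := solx.
  have e14 : 0 < e1 / 4 by rewrite divr_gt0.
  have T1 : T <= tau + 1 by lra.
  have [d dp Hd] :=
    abs_continuous_entry_unif x T (tau + 1) (acx _ _ T0 T1) _ e14.
  pose h := Num.min (d / 2) 1.
  have [h0 hd h1] : [/\ 0 < h, h <= d / 2 & h <= 1].
    by rewrite /h lt_min !ge_min !lexx orbT ltr01 divr_gt0.
  have [v [Tv fv]] := inf_adherent h0 hS; rewrite -/tau => vh.
  have tauv : tau <= v by apply: ge_inf; [case: hS | split].
  exists (x v) => // i.
  (* Either [s = T], with nothing to travel, or [s < tau], so that [x] is not flat on the whole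
     closed interval from [T] to [s]. *)
  pose s := Num.max T (tau - d / 4).
  have Ts : T <= s by rewrite /s le_max lexx.
  have stau : s <= tau by rewrite /s ge_max Ttau /=; lra.
  have sd : tau - d / 4 <= s by rewrite /s le_max lexx orbT.
  have xsv : `|x v i 0 - x s i 0| < e1 / 4 by apply: Hd; lra.
  have xTs : `|x s i 0 - x T i 0| <= e1 / 2.
    have [->|sT] := eqVneq s T; first by rewrite subrr normr0 divr_ge0 // ltW.
    have ltstau : s < tau.
      have Tlt : T < tau.
        rewrite lt_neqAle Ttau andbT; apply: contra_neq sT => Ttau_eq.
        by apply/eqP; rewrite eq_le Ts andbT Ttau_eq.
      by rewrite /s gt_max Tlt /=; lra.
    apply: le_trans (travel T s i T0 Ts _) _.
      by move=> u /andP[Tu us]; apply: before => //; exact: le_lt_trans ltstau.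
    have VT : V T <= V t0 by apply: Vdecr => //; exact: ltW.
    have Vs : ell <= V s by apply: Vell; lra.
    have : V T - V s <= e1 / (4 * K) by lra.
    have -> : e1 / 2 = 2 * K * (e1 / (4 * K)) by field; exact: lt0r_neq0.
    by rewrite ler_pM2l // mulr_gt0.
  rewrite distrC -[x v i 0](subrK (x s i 0)) -addrA.
  by apply: le_trans (ler_normD _ _) _; lra.
(* Decreasing at rate [c / 2] from [T] on, [V] would be at most [-1] at this time. *)
pose t1 := T + 2 * (V T + 1) / c.
have Tt1 : T <= t1 by rewrite lerDl divr_ge0 ?mulr_ge0 ?addr_ge0 // ltW.
have := Vdecr_lin T t1 T0 Tt1 (fun u H => never u (proj1 (andP H))).
have -> : c / 2 * t1 = c / 2 * T + (V T + 1).
  by rewrite /t1; field; exact: lt0r_neq0.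
have := V0 t1; lra.
Qed.
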